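(* Let $m=12q$ with $q$ a nonnegative integer. Then the minimal decomposition of $\mathbb{Z}_2$ for the Fibonacci polynomial $F_m$ is $$\mathbb{Z}_2=\{0\}\sqcup(\mathbb{Z}_2-\{0\}),$$ where $\{0\}$ is the set of a fixed point and $\mathbb{Z}_2-\{0\}$ is the attracting basin of $\{0\}$.
   Context: $\mathbb{Z}_2$ is the ring of 2-adic integers with the 2-adic metric. The Fibonacci polynomials are defined by $F_0(x)=0$, $F_1(x)=1$, $F_m(x)=xF_{m-1}(x)+F_{m-2}(x)$ for $m\ge 2$. For a polynomial $f$ over $\mathbb{Z}_2$, a minimal decomposition of $\mathbb{Z}_2$ for $f$ is a decomposition $\mathbb{Z}_2=\mathcal P\sqcup\mathcal M\sqcup\mathcal B$ (some parts possibly empty) in which: $\mathcal P$ is the finite set consisting of all periodic points of $f$; $\mathcal M=\bigsqcup_i\mathcal M_i$ is the union of all (at most countably many) clopen $f$-invariant sets $\mathcal M_i$ (the minimal components), each a finite union of balls, such that each $f:\mathcal M_i\to\mathcal M_i$ is minimal (every orbit is dense in $\mathcal M_i$); and each point of $\mathcal B$ lies in the attracting basin of a periodic orbit or of a minimal subsystem. A point $x$ lies in the attracting basin of a set $C$ (a periodic orbit or minimal component) if the distance from $f^n(x)$ to $C$ tends to $0$ as $n\to\infty$; when a part $\mathcal B$ of a decomposition is said to be the attracting basin of $C$, this means every point of $\mathcal B$ lies in the attracting basin of $C$ (the points of $C$ being listed separately). *)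

(* Defs.v *)
From HB Require Import structures.
From mathcomp Require Import all_boot all_order all_algebra.
From mathcomp Require Import all_classical all_reals all_analysis.

Set Implicit Arguments.
Unset Strict Implicit.
Unset Printing Implicit Defensive.

Import Order.TTheory GRing.Theory Num.Theory.

Local Open Scope classical_set_scope.
Local Open Scope ring_scope.

(* Z_2 is the inverse limit of the rings Z/2^n Z. An element is the sequence of
   its least nonnegative residues, residue x n being x mod 2^n; coherence also
   forces residue x n < 2 ^ n. *)
Definition coherent (u : nat -> nat) : bool :=
  `[< forall n, u n = (u n.+1 %% 2 ^ n)%N >].

Record Z2 := MkZ2 { residue : nat -> nat; _ : coherent residue }.

HB.instance Definition _ := [isSub for residue].
HB.instance Definition _ := [Choice of Z2 by <:].

Section Z2_ring.
Implicit Types x y z : Z2.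

Lemma residueS x n : residue x n = (residue x n.+1 %% 2 ^ n)%N.
Proof. by case: x => u /= /asboolP. Qed.

Lemma residue_mod x n : (residue x n %% 2 ^ n)%N = residue x n.
Proof. by rewrite residueS modn_mod. Qed.

Lemma Z2_eqP x y : (forall n, residue x n = residue y n) -> x = y.
Proof. by move=> xy; apply/val_inj/funext. Qed.

Lemma reduce_coherent (u : nat -> nat) :
  (forall n, (u n.+1 = u n %[mod 2 ^ n])%N) ->
  coherent (fun n => u n %% 2 ^ n)%N.
Proof.
by move=> uP; apply/asboolP => n; rewrite modn_dvdm ?uP// dvdn_exp2l.
Qed.

Definition reduce u uP := MkZ2 (@reduce_coherent u uP).

Lemma const_subproof (k : nat) n : (k = k %[mod 2 ^ n])%N. Proof. by []. Qed.

Lemma addZ2_subproof x y n :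
  (residue x n.+1 + residue y n.+1 = residue x n + residue y n %[mod 2 ^ n])%N.
Proof. by rewrite (residueS x n) (residueS y n) modnDm. Qed.

Lemma oppZ2_subproof x n :
  (2 ^ n.+1 - residue x n.+1 = 2 ^ n - residue x n %[mod 2 ^ n])%N.
Proof.
have le2 m : (residue x m <= 2 ^ m)%N.
  by rewrite -residue_mod ltnW// ltn_mod expn_gt0.
apply/eqP; rewrite -(eqn_modDr (residue x n.+1)) subnK// (residueS x n).
rewrite -modnDmr subnK ?modn_mod -?residueS//.
by rewrite expnS modnMl modnn.
Qed.

Lemma mulZ2_subproof x y n :
  (residue x n.+1 * residue y n.+1 = residue x n * residue y n %[mod 2 ^ n])%N.
Proof. by rewrite (residueS x n) (residueS y n) modnMm. Qed.

Definition natZ2 (k : nat) := reduce (const_subproof k).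
Definition addZ2 x y := reduce (addZ2_subproof x y).
Definition oppZ2 x := reduce (oppZ2_subproof x).
Definition mulZ2 x y := reduce (mulZ2_subproof x y).

Lemma addZ2A : associative addZ2.
Proof. by move=> x y z; apply: Z2_eqP => n /=; rewrite modnDml modnDmr addnA. Qed.
Lemma addZ2C : commutative addZ2.
Proof. by move=> x y; apply: Z2_eqP => n /=; rewrite addnC. Qed.
Lemma add0Z2 : left_id (natZ2 0) addZ2.
Proof. by move=> x; apply: Z2_eqP => n /=; rewrite mod0n add0n residue_mod. Qed.
Lemma addNZ2 : left_inverse (natZ2 0) oppZ2 addZ2.
Proof.
move=> x; apply: Z2_eqP => n /=; rewrite modnDml subnK ?modnn ?mod0n//.
by rewrite -residue_mod ltnW// ltn_mod expn_gt0.
Qed.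

HB.instance Definition _ :=
  GRing.isZmodule.Build Z2 addZ2A addZ2C add0Z2 addNZ2.

Lemma mulZ2A : associative mulZ2.
Proof. by move=> x y z; apply: Z2_eqP => n /=; rewrite modnMml modnMmr mulnA. Qed.
Lemma mulZ2C : commutative mulZ2.
Proof. by move=> x y; apply: Z2_eqP => n /=; rewrite mulnC. Qed.
Lemma mul1Z2 : left_id (natZ2 1) mulZ2.
Proof. by move=> x; apply: Z2_eqP => n /=; rewrite modnMml mul1n residue_mod. Qed.
Lemma mulZ2Dl : left_distributive mulZ2 +%R.
Proof.
by move=> x y z; apply: Z2_eqP => n /=; rewrite modnMml modnDm mulnDl.
Qed.
Lemma oneZ2_neq0 : natZ2 1 != 0.
Proof. by apply/eqP => /(congr1 (residue^~ 1%N)). Qed.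

HB.instance Definition _ :=
  GRing.Zmodule_isComNzRing.Build Z2 mulZ2A mulZ2C mul1Z2 mulZ2Dl oneZ2_neq0.

Lemma residue0 n : residue 0 n = 0%N. Proof. by rewrite /= mod0n. Qed.

Lemma residueD x y n :
  residue (x + y) n = ((residue x n + residue y n) %% 2 ^ n)%N.
Proof. by []. Qed.

Lemma residueM x y n :
  residue (x * y) n = ((residue x n * residue y n) %% 2 ^ n)%N.
Proof. by []. Qed.

Lemma residueB_eq0 x y n :
  (residue (x - y) n == 0%N) = (residue x n == residue y n).
Proof.
apply/eqP/eqP => [xy|xy].
  by rewrite -[x in LHS](subrK y) residueD xy add0n residue_mod.
by rewrite residueD xy -residueD subrr residue0.
Qed.

Lemma residue_le x y m n : (m <= n)%N ->
  residue x n = residue y n -> residue x m = residue y m.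
Proof.
move=> mn; rewrite -(subnK mn); elim: (n - m)%N => [//|k IH] xy.
by apply: IH; rewrite (residueS x) (residueS y) -addSn xy.
Qed.

End Z2_ring.

(* The 2-adic absolute value |x| = 2^-v, where 2^v is the largest power of 2
   dividing x, i.e. v is least with x <> 0 mod 2^(v+1); |0| = 0. *)
Definition abs2 (R : realType) (x : Z2) : R :=
  match pselect (exists n, residue x n.+1 != 0%N) with
  | left xn0 => 2 ^- ex_minn xn0
  | right _ => 0
  end.

Section abs2_theory.
Variable R : realType.
Implicit Types x y z : Z2.

Lemma abs2_ge0 x : 0 <= abs2 R x.
Proof. by rewrite /abs2; case: pselect => // ?; rewrite invr_ge0 exprn_ge0. Qed.

Lemma abs2_le x n : (abs2 R x <= 2 ^- n) = (residue x n == 0%N).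
Proof.
rewrite /abs2; case: pselect => [xn0|x0]; last first.
  rewrite invr_ge0 exprn_ge0//; apply/esym; case: n => [|n].
    by rewrite -residue_mod expn0 modn1.
  by apply/negPn/negP => xn; apply: x0; exists n.
case: ex_minnP => v xv vmin.
rewrite lef_pV2 ?posrE ?exprn_gt0// ler_eXn2l ?ltr1n//.
apply/idP/eqP => [nv|xn].
  case: n nv => [|n nv]; first by rewrite -residue_mod expn0 modn1.
  apply/eqP; rewrite -[_ == _]negbK; apply/negP => /vmin.
  by rewrite leqNgt nv.
rewrite leqNgt; apply/negP => vn; case/eqP: xv.
by rewrite -[RHS](residue0 v.+1); apply: residue_le vn _; rewrite xn residue0.
Qed.

Lemma abs2_eq0 x : abs2 R x = 0 -> x = 0.
Proof.
move=> x0; apply: Z2_eqP => n; rewrite residue0; apply/eqP.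
by rewrite -abs2_le x0 invr_ge0 exprn_ge0.
Qed.

Lemma abs20 : abs2 R 0 = 0.
Proof.
rewrite /abs2; case: pselect => // n0; exfalso.
by case: n0 => n; rewrite residue0.
Qed.

Lemma abs2_cases x : abs2 R x = 0 \/ exists n, abs2 R x = 2 ^- n.
Proof.
by rewrite /abs2; case: pselect => [xn0|_]; [right; eexists|left].
Qed.

Lemma abs2_le_le x y :
  (forall n, residue y n = 0%N -> residue x n = 0%N) -> abs2 R x <= abs2 R y.
Proof.
move=> yx; case: (abs2_cases y) => [y0|[n yn]].
  by rewrite (_ : x = 0) ?abs20 ?abs2_ge0//; apply: Z2_eqP => n;
    rewrite residue0 yx// (abs2_eq0 y0) residue0.
by rewrite yn abs2_le; apply/eqP/yx/eqP; rewrite -abs2_le yn.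
Qed.

Lemma abs2N x : abs2 R (- x) = abs2 R x.
Proof.
have N y n : residue y n = 0%N -> residue (- y) n = 0%N.
  by move=> y0; apply/eqP; rewrite -sub0r residueB_eq0 residue0 y0.
by apply/eqP; rewrite eq_le !abs2_le_le// => n; [rewrite -{2}[x]opprK|];
  apply: N.
Qed.

Lemma abs2D x y : abs2 R (x + y) <= Num.max (abs2 R x) (abs2 R y).
Proof.
wlog xy : x y / abs2 R x <= abs2 R y.
  move=> W; have [|/ltW] := leP (abs2 R x) (abs2 R y) => /[dup] h /W.
    by rewrite (max_idPr h).
  by rewrite (max_idPr h) addrC.
rewrite (max_idPr xy); apply: abs2_le_le => n yn.
have := abs2_le x n; rewrite (le_trans xy) ?abs2_le ?yn// => /esym/eqP xn.
by rewrite residueD xn yn mod0n.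
Qed.

End abs2_theory.

(* The topology and uniformity of Z_2 do not depend on the type R in which
   distances take their values: the entourages are generated by the
   congruences modulo 2^n. They are the ones of the 2-adic metric
   |x - y|, whatever R (lemma Z2_entourageE). *)
Section Z2_uniform.
Local Open Scope relation_scope.

Definition Z2_ent : set_system (Z2 * Z2) :=
  filter_from setT (fun n => [set xy | residue xy.1 n = residue xy.2 n]).

Lemma Z2_ent_filter : Filter Z2_ent.
Proof.
apply: filter_from_filter; first by exists 0%N.
move=> m n _ _; exists (maxn m n) => // -[x y] /= xy.
by split; apply: residue_le xy; rewrite ?leq_maxl ?leq_maxr.
Qed.

Lemma Z2_ent_diagonal A : Z2_ent A -> diagonal `<=` A.
Proof. by move=> [n _ nA] [x y] /= xy; apply: nA; rewrite /= (xy : x = y). Qed.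

Lemma Z2_ent_inv A : Z2_ent A -> Z2_ent A^-1.
Proof. by move=> [n _ nA]; exists n => // -[x y] /= xy; apply: nA. Qed.

Lemma Z2_ent_split A : Z2_ent A -> exists2 B, Z2_ent B & B \; B `<=` A.
Proof.
move=> [n _ nA]; exists [set xy | residue xy.1 n = residue xy.2 n].
  by exists n.
by move=> [x z] [y /= xy yz]; apply: nA => /=; rewrite xy.
Qed.

HB.instance Definition _ := isUniform.Build Z2
  Z2_ent_filter Z2_ent_diagonal Z2_ent_inv Z2_ent_split.

End Z2_uniform.

Section Z2_metric.
Variable R : realType.
Implicit Types x y z : Z2.

Definition dist2 x y : R := abs2 R (x - y).

Definition ball2 x (e : R) : set Z2 := [set y | dist2 x y < e].

Lemma ball2_center x (e : R) : 0 < e -> ball2 x e x.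
Proof. by rewrite /ball2/= /dist2 subrr abs20. Qed.

Lemma ball2_sym x y (e : R) : ball2 x e y -> ball2 y e x.
Proof. by rewrite /ball2/= /dist2 -abs2N opprB. Qed.

Lemma ball2_triangle x y z (e1 e2 : R) :
  ball2 x e1 y -> ball2 y e2 z -> ball2 x (e1 + e2) z.
Proof.
rewrite /ball2/= /dist2 => xy yz.
rewrite -[x](subrK y) -addrA (le_lt_trans (abs2D _ _ _))//.
have e1_gt0 := le_lt_trans (abs2_ge0 R _) xy.
have e2_gt0 := le_lt_trans (abs2_ge0 R _) yz.
by rewrite gt_max (lt_trans xy) ?ltrDl//= (lt_trans yz) ?ltrDr.
Qed.

Lemma Z2_entourageE : entourage = entourage_ ball2.
Proof.
rewrite eqEsubset; split => A.
  move=> [n _ nA]; exists (2 ^- n) => [/=|[x y] /= xy].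
    by rewrite invr_gt0 exprn_gt0.
  by apply: nA; apply/eqP; rewrite /= -residueB_eq0 -(abs2_le R) ltW.
move=> [e /= e_gt0 eA].
have [n en] : exists n, 2 ^- n < e.
  have [N _ /(_ N (leqnn N)) NP] := near_infty_natSinv_expn_lt (PosNum e_gt0).
  by exists N; move: NP; rewrite /= div1r.
exists n => // -[x y] /= /eqP; rewrite -residueB_eq0 -(abs2_le R) => xy.
by apply: eA; apply: le_lt_trans xy en.
Qed.

HB.instance Definition _ := Uniform_isPseudoMetric.Build R Z2
  ball2_center ball2_sym ball2_triangle Z2_entourageE.

Lemma dist2_ge0 x y : 0 <= dist2 x y. Proof. exact: abs2_ge0. Qed.

Lemma dist2_positivity x y : dist2 x y = 0 -> x = y.
Proof. by move=> /abs2_eq0/subr0_eq. Qed.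

Lemma ball_dist2 x (e : R) : ball x e = [set y | dist2 x y < e].
Proof. by []. Qed.

HB.instance Definition _ := PseudoMetric_isMetric.Build R Z2
  dist2_ge0 dist2_positivity ball_dist2.

End Z2_metric.

Section dynamics.
Context (R : realType) (T : metricType R).
Implicit Types (f : T -> T) (x : T) (A C : set T).

Definition forward_orbit f x : set T := range (fun n => iter n f x).

Definition periodic_point f x := exists2 n, (0 < n)%N & iter n f x = x.

Definition periodic_orbit f C :=
  exists2 x, periodic_point f x & C = forward_orbit f x.

Definition finite_union_of_balls A :=
  exists s : seq (T * {posnum R}),
    A = \bigcup_(b in [set` s]) ball b.1 b.2%:num.

(* Nonemptiness excludes the vacuously minimal empty set. *)
Definition minimal_component f A :=
  [/\ A !=set0, clopen A, f @` A `<=` A, finite_union_of_balls A &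
      forall x, A x -> A `<=` closure (forward_orbit f x)].

(* edist_inf C y is the distance inf_(c in C) d(y, c), in the extended reals. *)
Definition attracted_to f C x :=
  edist_inf C (iter n f x) @[n --> \oo] --> 0%E.

Record minimal_decomposition f (P M B : set T) : Prop := {
  decomposition_cover : P `|` M `|` B = setT ;
  decomposition_PM : P `&` M = set0 ;
  decomposition_PB : P `&` B = set0 ;
  decomposition_MB : M `&` B = set0 ;
  periodic_part_finite : finite_set P ;
  periodic_partE : P = [set x | periodic_point f x] ;
  components_countable : countable [set A | minimal_component f A] ;
  components_disjoint : trivIset [set A | minimal_component f A] id ;
  minimal_partE : M = \bigcup_(A in [set A | minimal_component f A]) A ;
  basin_part : forall x, B x -> exists2 C,
    periodic_orbit f C \/ minimal_component f C & attracted_to f C x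
}.

End dynamics.

Fixpoint fib_poly (A : comNzRingType) (m : nat) : {poly A} :=
  match m with
  | 0 => 0
  | k.+1 => if k is j.+1 then 'X * fib_poly A k + fib_poly A j else 1
  end.

(* Main.v *)
Require Import Defs.
From HB Require Import structures.
From mathcomp Require Import all_boot all_order all_algebra.
From mathcomp Require Import all_classical all_reals all_analysis.
From mathcomp Require Import ring.

Set Implicit Arguments.
Unset Strict Implicit.
Unset Printing Implicit Defensive.

Import Order.TTheory GRing.Theory Num.Theory.

Local Open Scope classical_set_scope.
Local Open Scope ring_scope.

(** The map F = F_(12q) contracts Z_2 towards 0: if 2^n divides x, then
    2^(n+1) divides F(x) ([fib_poly_contracting]). Two expansions of Fibonacci
    polynomials give this. The terms of F_(2k) of degree at most 1 are k x, so
    F(x) = x (6q + x h) for some h, and the second factor is even when x is; this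
    settles n > 0. For n = 0 the claim is that F(x) is even for every x: the
    same expansion shows it for x even, and for x odd it follows from the
    divisibility of F_(3k)(x) by F_3(x) = x^2 + 1.

    Everything else holds for any map with this contraction property
    ([contracting_minimal_decomposition]). The n-th iterate of any point is
    divisible by 2^n, hence all orbits converge to the fixed point 0 and 0 is
    the only periodic point. A minimal component would be closed, hence would
    contain the limit 0 of its orbits; minimality applied to the orbit of 0
    would reduce it to {0}, which is not open. So there is none. *)

Lemma fib_hornerS (A : comNzRingType) m (x : A) :
  (fib_poly A m.+2).[x] = x * (fib_poly A m.+1).[x] + (fib_poly A m).[x].
Proof. by rewrite /= hornerD hornerM hornerX. Qed.

(** The conjunct for odd indices is what the recurrence needs to pass from
    F_(2k) to F_(2k+2). *)
Lemma fib_horner_expansion (A : comNzRingType) k (x : A) :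
  (exists h, (fib_poly A k.*2).[x] = x * (k%:R + x * h)) /\
  (exists h, (fib_poly A k.*2.+1).[x] = 1 + x * h).
Proof.
elim: k => [|k [[h Eh] [h' Eh']]].
  by split; exists 0; rewrite ?horner0 ?hornerC; ring.
rewrite doubleS (fib_hornerS k.*2.+1) !(fib_hornerS k.*2) Eh Eh'.
split; first by exists (h + h'); ring.
by exists (h' + x * (1 + x * h') + x * (k%:R + x * h)); ring.
Qed.

(** Two steps of the recurrence give
    F_(m+3) = (x^2 + 1) F_(m+1) + x F_m, so divisibility by x^2 + 1
    propagates from m to m + 3. *)
Lemma fib_horner_dvd3 (A : comNzRingType) k (x : A) :
  exists u, (fib_poly A (3 * k)).[x] = (x ^+ 2 + 1) * u.
Proof.
elim: k => [|k [u Eu]]; first by exists 0; rewrite muln0 horner0 mulr0.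
rewrite mulnS -[(3 + _)%N]/((3 * k).+3) 2!fib_hornerS Eu.
by exists ((fib_poly A (3 * k).+1).[x] + x * u); ring.
Qed.

Lemma residue_oneP x : residue x 1 = 0%N \/ residue x 1 = 1%N.
Proof.
have: (residue x 1 < 2)%N by rewrite -residue_mod ltn_mod.
by case: (residue x 1) => [|[|//]]; [left|right].
Qed.

Lemma residue_zero x : residue x 0 = 0%N.
Proof. by rewrite -residue_mod modn1. Qed.

Lemma residue_eq0_le x m n :
  (m <= n)%N -> residue x n = 0%N -> residue x m = 0%N.
Proof.
by move=> mn xn; rewrite (residue_le mn (y := 0)) residue0.
Qed.

Lemma residueM_eq0 x y m n :
  residue x m = 0%N -> residue y n = 0%N -> residue (x * y) (m + n) = 0%N.
Proof.
have dvd z i j : residue z i = 0%N -> (2 ^ i %| residue z (i + j))%N.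
  move=> zi; elim: j => [|j]; first by rewrite addn0 zi dvdn0.
  rewrite residueS /dvdn modn_dvdm ?dvdn_exp2l ?leq_addr//.
  by rewrite addnS.
move=> xm yn; rewrite residueM; apply/eqP; rewrite -/(dvdn _ _) expnD.
by apply: dvdn_mul; [exact: dvd|rewrite addnC; exact: dvd].
Qed.

Lemma nbhs0P (U : set Z2) :
  nbhs (0 : Z2) U <-> exists n, forall y, residue y n = 0%N -> U y.
Proof.
rewrite -nbhs_entourageE; split.
  move=> [E [n _ nE] EU]; exists n => y yn; apply: EU.
  by apply/xsectionP; apply: nE; rewrite /= yn; exact: residue0.
move=> [n nU]; exists [set xy | residue xy.1 n = residue xy.2 n].
  by exists n.
by move=> y /xsectionP /= yn; apply: nU; rewrite -yn; exact: residue0.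
Qed.

(** The point 0 is not isolated, since 2^n is nonzero and tends to 0. *)
Lemma not_open_set0 : ~ open ([set 0] : set Z2).
Proof.
move=> o0; have /nbhs0P[n n0] : nbhs (0 : Z2) [set 0].
  exact: open_nbhs_nbhs.
have /n0 : residue (natZ2 (2 ^ n)) n = 0%N by rewrite /= modnn.
move=> /(congr1 (residue^~ n.+1)); rewrite residue0 /=.
by rewrite modn_small ?ltn_exp2l// => /eqP; rewrite expn_eq0.
Qed.

(** In terms of the 2-adic absolute value, |f x| <= |x| / 2. *)
Definition contracting (f : Z2 -> Z2) :=
  forall n x, residue x n = 0%N -> residue (f x) n.+1 = 0%N.

(** The exponent of 2 is raised by the factor 6q + x h when x is even; an odd
    x satisfies the hypothesis for n = 0 only, and there x^2 + 1 provides
    the factor 2. *)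
Lemma fib_poly_contracting q : contracting (horner (fib_poly Z2 (12 * q))).
Proof.
move=> n x xn; set F := _.[x].
have [[h Fh] _] := fib_horner_expansion (6 * q) x.
have FE : F = x * (2%:R * (3 * q)%:R + x * h).
  by rewrite -natrM mulnA -Fh -mul2n mulnA.
have dvd2 : residue (2%:R : Z2) 1 = 0%N by [].
have [x1|x1] := residue_oneP x.
  (* Both summands of the cofactor of x in FE are even. *)
  rewrite FE -[n.+1]addn1; apply: residueM_eq0 => //.
  rewrite residueD (@residueM_eq0 _ _ 1 0 dvd2 (residue_zero _)).
  by rewrite (@residueM_eq0 _ _ 1 0 x1 (residue_zero _)).
have -> : n = 0%N.
  by case: n xn => // n /(residue_eq0_le (ltn0Sn n)); rewrite x1.
have [u Fu] := fib_horner_dvd3 (4 * q) x.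
rewrite /F (_ : (12 * q = 3 * (4 * q))%N); last by rewrite mulnA.
have sqr1_even : residue (x ^+ 2 + 1) 1 = 0%N.
  by rewrite residueD expr2 residueM x1.
by rewrite Fu (@residueM_eq0 _ _ 1 0 sqr1_even (residue_zero u)).
Qed.

Section contracting_maps.
Variables (f : Z2 -> Z2) (fP : contracting f).

Lemma contracting_iter k n x :
  residue x n = 0%N -> residue (iter k f x) (k + n) = 0%N.
Proof. by move=> xn; elim: k => [//|k IH]; rewrite addSn iterS; apply: fP. Qed.

Lemma contracting_fix0 : f 0 = 0.
Proof.
apply: Z2_eqP => n; rewrite residue0.
by apply: (residue_eq0_le (leqnSn n)); apply: fP; rewrite residue0.
Qed.

Lemma contracting_iter0 k : iter k f 0 = 0.
Proof. by elim: k => [//|k IH]; rewrite iterS IH contracting_fix0. Qed.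

(** A point of period k is its own (n k)-th iterate, hence divisible by
    2^(n k) for every n. *)
Lemma contracting_periodic0 (R : realType) x :
  @periodic_point R Z2 f x -> x = 0.
Proof.
move=> [k k0 xk]; apply: Z2_eqP => n; rewrite residue0.
have fix_mul j : iter (j * k) f x = x.
  by elim: j => [//|j IH]; rewrite mulSn iterD IH.
apply: (residue_eq0_le (leq_pmulr n k0)).
rewrite -[x in LHS](fix_mul n) -[X in residue _ X]addn0.
exact/contracting_iter/residue_zero.
Qed.

Lemma contracting_cvg0 x : iter n f x @[n --> \oo] --> (0 : Z2).
Proof.
move=> U /nbhs0P[N NU]; exists N => // n /= Nn; apply: NU.
apply: (residue_eq0_le Nn); rewrite -[X in residue _ X]addn0.
exact/contracting_iter/residue_zero.
Qed.

(** The distance to {0} is continuous, so the convergence of the orbit to 0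
    transfers to it. *)
Lemma contracting_attracted0 (R : realType) x :
  @attracted_to R Z2 f [set 0] x.
Proof.
rewrite /attracted_to -(@edist_inf0 R Z2 [set 0] 0)//.
apply: cvg_comp (@contracting_cvg0 x) _.
exact: edist_inf_continuous.
Qed.

(** Closedness puts the attractor 0 into A, minimality at 0 then forces
    A = {0}, and openness rules this out. *)
Lemma contracting_no_minimal_component (R : realType) A :
  ~ @minimal_component R Z2 f A.
Proof.
move=> [[x Ax] [oA cA] fA _ minA].
have A0 : A 0.
  apply: cA => U /(@contracting_cvg0 x)[N _ /(_ N (leqnn N)) UN].
  exists (iter N f x); split=> //.
  by elim: N {UN} => [//|n IH]; apply: fA; exists (iter n f x).
have A_sub0 : A `<=` [set 0].
  move=> y /(minA 0 A0).
  rewrite (_ : forward_orbit f 0 = [set 0]).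
    have /closure_id <- // : closed ([set 0] : set Z2).
    exact/accessible_closed_set1/hausdorff_accessible/(@metric_hausdorff R Z2).
  by rewrite eqEsubset; split => [_ [n _ <-]|_ ->];
    [rewrite contracting_iter0|exists 0%N].
apply: not_open_set0; rewrite (_ : [set 0] = A)//.
by rewrite eqEsubset; split => // _ ->.
Qed.

Lemma contracting_minimal_decomposition (R : realType) :
  @minimal_decomposition R Z2 f [set 0] set0 (~` [set 0]).
Proof.
have periodic0 : @periodic_point R Z2 f 0.
  by exists 1%N => //=; exact: contracting_fix0.
have noM : [set A | @minimal_component R Z2 f A] = set0.
  by rewrite -subset0 => A /contracting_no_minimal_component.
split.
- by rewrite setU0 setUCr.
- by rewrite setI0.
- by rewrite setICr.
- by rewrite set0I.
- exact: finite_set1.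
- rewrite eqEsubset; split => [_ ->//|x]; exact: contracting_periodic0.
- by rewrite noM; exact: countable0.
- by rewrite noM => A B [].
- by rewrite noM bigcup_set0.
- move=> x _; exists [set 0]; last exact: contracting_attracted0.
  left; exists 0 => //.
  by rewrite eqEsubset; split => [_ ->|_ [n _ <-]];
    [exists 0%N|rewrite contracting_iter0].
Qed.

End contracting_maps.

Theorem theorem4p1 (R : realType) (m q : nat) (hm : m = (12 * q)%N) :
  let F : Z2 -> Z2 := horner (fib_poly Z2 m) in
  [/\ @minimal_decomposition R Z2 F [set 0] set0 (~` [set 0]),
      F 0 = 0 &
      forall x : Z2, (~` [set 0]) x -> @attracted_to R Z2 F [set 0] x].
Proof.
move=> F; have FP : contracting F by rewrite /F hm; exact: fib_poly_contracting.
split; first exact: contracting_minimal_decomposition.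
- exact: contracting_fix0.
- by move=> x _; exact: contracting_attracted0.
Qed.
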